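(* Let $n \geq 1$ be a finite natural number and let $A$ and $B$ be arbitrary sets (finite or infinite). If there is an injection from $n \times A$ to $n \times B$, then there is an injection from $A$ to $B$. In symbols: $n \times A \preceq n \times B \implies A \preceq B$.
   Context: Write $A \preceq B$ if there exists an injection from $A$ to $B$. Here $n$ also denotes the set $\{0,1,\ldots,n-1\}$, so $n \times A$ is the Cartesian product of an $n$-element set with $A$ (the disjoint union of $n$ copies of $A$). The result is understood in set theory without the axiom of choice or the well-ordering principle in any form (the power set axiom and the axiom of infinity are likewise not needed): the result is to be effective, i.e. the injection $A \to B$ is obtained explicitly from the given injection $n \times A \to n \times B$ without arbitrary choices. *)

(* Defs.v *)
Set Implicit Arguments.
Unset Strict Implicit.

(* The theorem belongs to a weak set theory without choice. Stated for Rocq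
   types it would admit proofs that use choice in the metatheory, so it is
   stated for arbitrary models (M, mem) of ZF without the axioms of infinity
   and power set: a map "exists" only if it is an element of the model, and the
   schemas of separation and replacement range over first-order formulas only,
   so that no choice in the metatheory provides elements of the model. *)

(* First-order formulas in the language of membership; variables are de Bruijn
   indices, and a quantifier binds index 0 in its body. *)
Inductive formula : Type :=
| fMem (i j : nat)
| fEq (i j : nat)
| fFalse
| fAnd (p q : formula)
| fOr (p q : formula)
| fImp (p q : formula)
| fAll (p : formula)
| fEx (p : formula).

Definition scons (T : Type) (x : T) (e : nat -> T) : nat -> T :=
  fun k => match k with O => x | S k' => e k' end.

Infix ".:" := scons (at level 55, right associativity).

Fixpoint sat (M : Type) (mem : M -> M -> Prop) (e : nat -> M) (p : formula)
  : Prop :=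
  match p with
  | fMem i j => mem (e i) (e j)
  | fEq i j => e i = e j
  | fFalse => False
  | fAnd p q => sat mem e p /\ sat mem e q
  | fOr p q => sat mem e p \/ sat mem e q
  | fImp p q => sat mem e p -> sat mem e q
  | fAll p => forall x, sat mem (x .: e) p
  | fEx p => exists x, sat mem (x .: e) p
  end.

(* In the two schemas the valuation [e] supplies arbitrary parameters. *)
Record ZF_without_infinity_powerset (M : Type) (mem : M -> M -> Prop) : Prop := {
  ax_extensionality : forall x y, (forall z, mem z x <-> mem z y) -> x = y;
  ax_pairing : forall x y, exists p, forall z, mem z p <-> z = x \/ z = y;
  ax_union : forall x, exists u, forall z,
    mem z u <-> exists y, mem y x /\ mem z y;
  ax_foundation : forall x, (exists y, mem y x) ->
    exists y, mem y x /\ forall z, mem z y -> ~ mem z x;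
  ax_separation : forall (p : formula) (e : nat -> M) x, exists s, forall z,
    mem z s <-> mem z x /\ sat mem (z .: e) p;
  ax_replacement : forall (p : formula) (e : nat -> M) x,
    (forall u v w, mem u x ->
       sat mem (u .: v .: e) p -> sat mem (u .: w .: e) p -> v = w) ->
    exists r, forall v, mem v r <-> exists u, mem u x /\ sat mem (u .: v .: e) p
}.

Section SetNotions.

Variables (M : Type) (mem : M -> M -> Prop).

Definition is_empty (x : M) : Prop := forall z, ~ mem z x.

Definition is_succ (s x : M) : Prop := forall z, mem z s <-> mem z x \/ z = x.

Definition transitive (x : M) : Prop :=
  forall y, mem y x -> forall z, mem z y -> mem z x.

(* Under foundation, a transitive set of transitive sets is an ordinal. *)
Definition is_ordinal (x : M) : Prop :=
  transitive x /\ forall y, mem y x -> transitive y.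

(* Von Neumann natural numbers, so that n = {0, ..., n-1}: the ordinals with no
   limit ordinal below or equal to them. *)
Definition is_natural (n : M) : Prop :=
  is_ordinal n /\
  forall k, mem k n \/ k = n -> is_empty k \/ exists j, is_succ k j.

Definition is_upair (p x y : M) : Prop := forall z, mem z p <-> z = x \/ z = y.

(* Kuratowski pairs {{x}, {x, y}}. *)
Definition is_opair (p x y : M) : Prop :=
  exists s d, is_upair s x x /\ is_upair d x y /\ is_upair p s d.

Definition is_product (p x y : M) : Prop :=
  forall z, mem z p <-> exists a b, mem a x /\ mem b y /\ is_opair z a b.

Definition maps_to (f x y : M) : Prop := exists p, mem p f /\ is_opair p x y.

Definition is_function (f X Y : M) : Prop :=
  (forall p, mem p f -> exists x y, mem x X /\ mem y Y /\ is_opair p x y) /\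
  (forall x, mem x X -> exists! y, maps_to f x y).

Definition is_injection (f X Y : M) : Prop :=
  is_function f X Y /\
  forall x x' y, maps_to f x y -> maps_to f x' y -> x = x'.

Definition preceq (X Y : M) : Prop := exists f, is_injection f X Y.

End SetNotions.

(* Submission.v *)
From Stdlib Require Import Classical.
Require Import Defs.

(** Call (i, a) in n x A the card of suit i and rank a, (j, b) in n x B the
    place j in the hand of player b, and suit 0 the spades; an injection deals
    the cards. In each round every player who holds a spade swaps the one in the
    lowest place into place 0, where it stays forever, and then every spade that
    lies in a place j <> 0, in a hand whose place 0 holds the spade of rank k, is
    swapped with the card (j, k). After that (j, k) lies in place j next to its
    spade and never moves again, so each card is visited at most once, by one
    spade, at one time. Every rank either settles (its spade reaches a place 0)
    or runs away, visiting a new card (j, k) of a settled rank k in every round.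
    A runaway has a least suit j that it visits unboundedly often; shifting
    ranks along these visits, for j = 0, 1, ..., n-1 in turn, is a Hilbert hotel
    that absorbs the runaways into the settled ranks, each of which owns a
    player. All of this is first-order definable from n, A, B and the injection.
    Rounds are counted by the natural numbers of the model, which need not form
    a set and may be nonstandard: inductions are on definable predicates only,
    and the state after t rounds is given by a computation in the model. *)

(** * First-order definability of predicates *)

Set Implicit Arguments.
Unset Strict Implicit.

(* The formula is uniform in the model. Inside [P], the variables are the values
   [e k] of the valuation at numerals [k]. *)
Definition definable (P : forall M : Type, (M -> M -> Prop) -> (nat -> M) -> Prop) :=
  exists p, forall M mem e, sat mem e p <-> P M mem e.

Lemma def_mem i j : definable (fun M mem e => mem (e i) (e j)).
Proof. exists (fMem i j); simpl; tauto. Qed.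

Lemma def_eq i j : definable (fun M mem e => e i = e j).
Proof. exists (fEq i j); simpl; tauto. Qed.

Section Connectives.

Variables P Q : forall M : Type, (M -> M -> Prop) -> (nat -> M) -> Prop.
Hypotheses (defP : definable P) (defQ : definable Q).

Lemma def_and : definable (fun M mem e => P mem e /\ Q mem e).
Proof.
destruct defP as [p Hp], defQ as [q Hq]; exists (fAnd p q); intros M mem e; simpl.
rewrite Hp, Hq; tauto.
Qed.

Lemma def_or : definable (fun M mem e => P mem e \/ Q mem e).
Proof.
destruct defP as [p Hp], defQ as [q Hq]; exists (fOr p q); intros M mem e; simpl.
rewrite Hp, Hq; tauto.
Qed.

Lemma def_imp : definable (fun M mem e => P mem e -> Q mem e).
Proof.
destruct defP as [p Hp], defQ as [q Hq]; exists (fImp p q); intros M mem e; simpl.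
rewrite Hp, Hq; tauto.
Qed.

Lemma def_not : definable (fun M mem e => ~ P mem e).
Proof.
destruct defP as [p Hp]; exists (fImp p fFalse); intros M mem e; simpl.
rewrite Hp; tauto.
Qed.

End Connectives.

Lemma def_iff (P Q : forall M : Type, (M -> M -> Prop) -> (nat -> M) -> Prop) :
  definable P -> definable Q -> definable (fun M mem e => P M mem e <-> Q M mem e).
Proof. intros HP HQ; exact (def_and (def_imp HP HQ) (def_imp HQ HP)). Qed.

Section Quantifiers.

Variable P : forall M : Type, (M -> M -> Prop) -> (nat -> M) -> M -> Prop.
Hypothesis defP : definable (fun M mem e => P mem (fun k => e (S k)) (e 0)).

Lemma def_all : definable (fun M mem e => forall x : M, P mem e x).
Proof.
destruct defP as [p Hp]; exists (fAll p); intros M mem e.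
(* For [x .: e], the shifted valuation converts to [e] by eta and the value at 0 to [x]. *)
split; intros H x; [apply (Hp M mem (x .: e)) | apply Hp]; exact (H x).
Qed.

Lemma def_ex : definable (fun M mem e => exists x : M, P mem e x).
Proof.
destruct defP as [p Hp]; exists (fEx p); intros M mem e.
split; intros [x H]; exists x; [apply (Hp M mem (x .: e)) | apply Hp]; exact H.
Qed.

End Quantifiers.

Create HintDb definable.
#[local] Hint Resolve def_mem def_eq : definable.

(** Reads a formula off the shape of the predicate. Hints come before connectives, so that
    established predicates stay folded. Each quantifier shifts the parameters to [e (S k)], so atoms
    keep the form [e k] at numerals. *)
Ltac def := cbv beta;
  repeat (first [ solve [auto with definable nocore]
                | simple apply def_all | simple apply def_ex | simple apply def_and
                | simple apply def_or | simple apply def_iff | simple apply def_not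
                | simple apply def_imp ]; cbv beta).

Lemma def_empty x : definable (fun M mem e => is_empty mem (e x)).
Proof. unfold is_empty; def. Qed.

Lemma def_succ s x : definable (fun M mem e => is_succ mem (e s) (e x)).
Proof. unfold is_succ; def. Qed.
#[local] Hint Resolve def_empty def_succ : definable.

Lemma def_natural x : definable (fun M mem e => is_natural mem (e x)).
Proof. unfold is_natural, is_ordinal, transitive; def. Qed.

Lemma def_opair p x y : definable (fun M mem e => is_opair mem (e p) (e x) (e y)).
Proof. unfold is_opair, is_upair; def. Qed.
#[local] Hint Resolve def_natural def_opair : definable.

Lemma def_maps_to f x y : definable (fun M mem e => maps_to mem (e f) (e x) (e y)).
Proof. unfold maps_to; def. Qed.
#[local] Hint Resolve def_maps_to : definable.

(** * Deals, rounds, visits and the Hilbert hotel as predicates *)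

Section Predicates.

Variables (M : Type) (mem : M -> M -> Prop).

(* The deal [F] puts the card (i, a) in the place (j, b). *)
Definition places (F i a j b : M) :=
  exists c p, is_opair mem c i a /\ is_opair mem p j b /\ maps_to mem F c p.

(** An injection of n x A into n x B as a relation between coordinates, so that it also covers
    intermediate deals that are not given as sets of the model. *)
Record placement (n A B : M) (R : M -> M -> M -> M -> Prop) : Prop := {
  pl_range : forall i a j b, R i a j b -> mem i n /\ mem a A /\ mem j n /\ mem b B;
  pl_total : forall i a, mem i n -> mem a A -> exists j b, R i a j b;
  pl_fun : forall i a j b j' b', R i a j b -> R i a j' b' -> j = j' /\ b = b';
  pl_inj : forall i a i' a' j b, R i a j b -> R i' a' j b -> i = i' /\ a = a'
}.

(* [l] is the lowest place in which player [b] holds a spade. *)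
Definition lead (R : M -> M -> M -> M -> Prop) (o b l : M) :=
  (exists a, R o a l b) /\ forall l', mem l' l -> forall a, ~ R o a l' b.

(* Places [o] and [l] of each player with lead [l] are exchanged. *)
Definition shape R (o i a j b : M) :=
  exists j0, R i a j0 b /\
    (lead R o b j0 /\ j = o \/
     ~ lead R o b j0 /\ j0 = o /\ lead R o b j \/
     ~ lead R o b j0 /\ (j0 = o -> forall l, ~ lead R o b l) /\ j = j0).

(* The spade of [q] is about to be exchanged with the card (j, k). *)
Definition visits (R : M -> M -> M -> M -> Prop) (o q j k : M) :=
  j <> o /\ exists b, R o q j b /\ R o k o b.

(** Dual to [shape]: there places are exchanged after dealing, here cards before dealing. The cases
    are a visiting spade, a visited card and any other card; the first two take the position of
    their partner. *)
Definition ship R (o i a j b : M) :=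
  (i = o /\ exists j0 k, visits R o a j0 k /\ R j0 k j b) \/
  (exists q, visits R o q i a /\ R o q j b) \/
  (~ (i = o /\ exists j0 k, visits R o a j0 k) /\ ~ (exists q, visits R o q i a) /\
   R i a j b).

Definition round (o F F' : M) :=
  forall z, mem z F' <->
    exists i a j b c p, is_opair mem c i a /\ is_opair mem p j b /\ is_opair mem z c p /\
      ship (shape (places F) o) o i a j b.

(** [h] is a computation from [x] with stages 0 to [k]; [next] also receives the stage number.
    Quantifying over such sets makes iteration first-order even if the stages altogether do not form
    a set. *)
Definition run (next : M -> M -> M -> Prop) (o x k h : M) :=
  maps_to mem h o x /\
  (forall i u, maps_to mem h i u -> mem i k \/ i = k) /\
  (forall i u v, maps_to mem h i u -> maps_to mem h i v -> u = v) /\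
  (forall i, mem i k -> exists s u v, is_succ mem s i /\
     maps_to mem h i u /\ maps_to mem h s v /\ next i u v).

Definition iter next o x k y := exists h, run next o x k h /\ maps_to mem h k y.

Definition state (o f t F : M) :=
  is_natural mem t /\ iter (fun _ => round o) o f t F.

Definition visit (o f t q j k : M) :=
  exists F, state o f t F /\ visits (shape (places F) o) o q j k.

Definition settled_at (o f t k b : M) := exists F, state o f t F /\ places F o k o b.

Definition settled (o f k b : M) := exists t, settled_at o f t k b.

Definition runaway (o A f q : M) := mem q A /\ forall b, ~ settled o f q b.

Definition unbounded (o f q j : M) :=
  forall t, is_natural mem t -> exists t' k, mem t t' /\ visit o f t' q j k.

Definition column (o A f q j : M) :=
  runaway o A f q /\ unbounded o f q j /\ forall j', mem j' j -> ~ unbounded o f q j'.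

(* The tokens of the Hilbert hotel: a runaway enters at its first visit in suit
   [j], and a visited rank goes to the next visit of its visitor in suit [j]. *)
Definition hop (o A f j x y : M) :=
  (column o A f x j /\ exists t, visit o f t x j y /\
     forall s, mem s t -> forall k, ~ visit o f s x j k) \/
  (exists w t t', column o A f w j /\ mem t t' /\ visit o f t w j x /\
     visit o f t' w j y /\
     forall s, mem t s -> mem s t' -> forall k, ~ visit o f s w j k).

Definition move (o A f j x y : M) :=
  hop o A f j x y \/ (forall z, ~ hop o A f j x z) /\ y = x.

(** The stage number of the iteration serves as the suit, so the hotels of suits 0, ..., n-1 act in
    turn; the resulting rank is then replaced by the player that it owns. *)
Definition quotient (o n A f a b : M) :=
  exists y, iter (move o A f) o a n y /\ settled o f y b.

(** [o] is bound here, so that the defining formula has no parameters besides n, A, B and f. *)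
Definition is_quotient (n A B f g : M) :=
  exists o, is_empty mem o /\ forall z, mem z g <->
    exists a b, mem a A /\ mem b B /\ is_opair mem z a b /\ quotient o n A f a b.

End Predicates.

(** * Definability of the game and of the quotient *)

Lemma def_places F i a j b :
  definable (fun M mem e => places mem (e F) (e i) (e a) (e j) (e b)).
Proof. unfold places; def. Qed.
#[local] Hint Resolve def_places : definable.

Lemma def_placement n A B F : definable (fun M mem e =>
  placement mem (e n) (e A) (e B) (places mem (e F))).
Proof.
(* [def] sees only connectives, so the fields of the record are spelled out as a conjunction. *)
assert (H : definable (fun M mem e =>
  (forall i a j b, places mem (e F) i a j b ->
     mem i (e n) /\ mem a (e A) /\ mem j (e n) /\ mem b (e B)) /\
  (forall i a, mem i (e n) -> mem a (e A) -> exists j b, places mem (e F) i a j b) /\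
  (forall i a j b j' b', places mem (e F) i a j b -> places mem (e F) i a j' b' ->
     j = j' /\ b = b') /\
  (forall i a i' a' j b, places mem (e F) i a j b -> places mem (e F) i' a' j b ->
     i = i' /\ a = a'))) by def.
destruct H as [p Hp]; exists p; intros M mem e; rewrite Hp; split.
  intros (H1 & H2 & H3 & H4); split; assumption.
intros [H1 H2 H3 H4]; auto.
Qed.

Lemma def_shape F o i a j b :
  definable (fun M mem e => shape mem (places mem (e F)) (e o) (e i) (e a) (e j) (e b)).
Proof. unfold shape, lead; def. Qed.
#[local] Hint Resolve def_placement def_shape : definable.

Lemma def_visits F o q j k : definable (fun M mem e =>
  visits (shape mem (places mem (e F)) (e o)) (e o) (e q) (e j) (e k)).
Proof. unfold visits; def. Qed.
#[local] Hint Resolve def_visits : definable.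

Lemma def_round o F F' : definable (fun M mem e => round mem (e o) (e F) (e F')).
Proof. unfold round, ship; def. Qed.
#[local] Hint Resolve def_round : definable.

Lemma def_state o f t F :
  definable (fun M mem e => state mem (e o) (e f) (e t) (e F)).
Proof. unfold state, iter, run; def. Qed.
#[local] Hint Resolve def_state : definable.

Lemma def_visit o f t q j k :
  definable (fun M mem e => visit mem (e o) (e f) (e t) (e q) (e j) (e k)).
Proof. unfold visit; def. Qed.

Lemma def_settled_at o f t k b :
  definable (fun M mem e => settled_at mem (e o) (e f) (e t) (e k) (e b)).
Proof. unfold settled_at; def. Qed.
#[local] Hint Resolve def_visit def_settled_at : definable.

Lemma def_runaway o A f q :
  definable (fun M mem e => runaway mem (e o) (e A) (e f) (e q)).
Proof. unfold runaway, settled; def. Qed.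

Lemma def_unbounded o f q j :
  definable (fun M mem e => unbounded mem (e o) (e f) (e q) (e j)).
Proof. unfold unbounded; def. Qed.
#[local] Hint Resolve def_runaway def_unbounded : definable.

Lemma def_column o A f q j :
  definable (fun M mem e => column mem (e o) (e A) (e f) (e q) (e j)).
Proof. unfold column; def. Qed.
#[local] Hint Resolve def_column : definable.

Lemma def_hop o A f j x y :
  definable (fun M mem e => hop mem (e o) (e A) (e f) (e j) (e x) (e y)).
Proof. unfold hop; def. Qed.
#[local] Hint Resolve def_hop : definable.

Lemma def_iter_move o A f x k y : definable (fun M mem e =>
  iter mem (move mem (e o) (e A) (e f)) (e o) (e x) (e k) (e y)).
Proof. unfold iter, run, move; def. Qed.
#[local] Hint Resolve def_iter_move : definable.

Lemma def_quotient o n A f a b :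
  definable (fun M mem e => quotient mem (e o) (e n) (e A) (e f) (e a) (e b)).
Proof. unfold quotient, settled; def. Qed.
#[local] Hint Resolve def_quotient : definable.

Lemma def_is_quotient n A B f g :
  definable (fun M mem e => is_quotient mem (e n) (e A) (e B) (e f) (e g)).
Proof. unfold is_quotient; def. Qed.

(** * Axiom schemas for definable predicates, pairs and products *)

Section SetTheory.

Variables (M : Type) (mem : M -> M -> Prop).
Hypothesis ZF : ZF_without_infinity_powerset mem.

Notation nat_ := (is_natural mem).

Section Schemas.

Variable P : forall M : Type, (M -> M -> Prop) -> (nat -> M) -> Prop.
Hypothesis defP : definable P.
Variable e : nat -> M.

Lemma separation X :
  exists s, forall z, mem z s <-> mem z X /\ P mem (z .: e).
Proof.
destruct defP as [p Hp], (ax_separation ZF p e X) as [s Hs]; exists s; intros z.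
rewrite Hs, (Hp M mem); tauto.
Qed.

Lemma replacement X :
  (forall u v w, mem u X -> P mem (u .: v .: e) -> P mem (u .: w .: e) -> v = w) ->
  exists r, forall v, mem v r <-> exists u, mem u X /\ P mem (u .: v .: e).
Proof.
destruct defP as [p Hp]; intros H.
destruct (@ax_replacement M mem ZF p e X) as [r Hr].
  intros u v w Hu Hv Hw; apply (H u v w Hu); apply Hp; assumption.
exists r; intros v; rewrite Hr; split; intros [u [Hu Hv]]; exists u; split; trivial;
  apply Hp; trivial.
Qed.

(** Foundation for the subset that separation cuts out of [X]. *)
Lemma minimal_element X :
  (exists k, mem k X /\ P mem (k .: e)) ->
  exists k, mem k X /\ P mem (k .: e) /\
    forall i, mem i X -> mem i k -> ~ P mem (i .: e).
Proof.
destruct (separation X) as [s Hs]; intros [k0 Hk0].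
destruct (@ax_foundation M mem ZF s) as [k [Hk Hmin]].
  exists k0; apply Hs; exact Hk0.
apply Hs in Hk; destruct Hk as [Hk HP].
exists k; repeat split; trivial; intros i Hi Hik HPi.
apply (Hmin i Hik); apply Hs; split; trivial.
Qed.

End Schemas.

Lemma upair_exists x y : exists p, is_upair mem p x y.
Proof. exact (ax_pairing ZF x y). Qed.

Lemma opair_exists x y : exists p, is_opair mem p x y.
Proof.
destruct (upair_exists x x) as [s Hs], (upair_exists x y) as [d Hd].
destruct (upair_exists s d) as [p Hp]; exists p, s, d; auto.
Qed.

Lemma upair_unique p p' x y : is_upair mem p x y -> is_upair mem p' x y -> p = p'.
Proof.
intros H H'; apply (ax_extensionality ZF); intros z; rewrite (H z), (H' z); tauto.
Qed.

Lemma opair_unique p p' x y : is_opair mem p x y -> is_opair mem p' x y -> p = p'.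
Proof.
intros (s & d & Hs & Hd & Hp) (s' & d' & Hs' & Hd' & Hp').
rewrite <- (upair_unique Hs Hs'), <- (upair_unique Hd Hd') in Hp'.
exact (upair_unique Hp Hp').
Qed.

Lemma opair_inj p x y x' y' :
  is_opair mem p x y -> is_opair mem p x' y' -> x = x' /\ y = y'.
Proof.
(* The intersection and the union of the members determine x, then y. *)
assert (Hcap : forall p x y, is_opair mem p x y ->
          forall z, (forall w, mem w p -> mem z w) <-> z = x).
  intros q u v (s & d & Hs & Hd & Hq) z; split.
    intros H; assert (Hz := H s (proj2 (Hq s) (or_introl eq_refl))).
    apply Hs in Hz; tauto.
  intros -> w Hw; apply Hq in Hw; destruct Hw as [-> | ->]; [apply Hs | apply Hd]; auto.
assert (Hcup : forall p x y, is_opair mem p x y ->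
          forall z, (exists w, mem w p /\ mem z w) <-> z = x \/ z = y).
  intros q u v (s & d & Hs & Hd & Hq) z; split.
    intros (w & Hw & Hz); apply Hq in Hw; destruct Hw as [-> | ->];
      [apply Hs in Hz | apply Hd in Hz]; tauto.
  intros H; exists d; split; [apply Hq; auto | apply Hd; exact H].
intros H H'; assert (Hx : x = x').
  apply (Hcap _ _ _ H'); apply (Hcap _ _ _ H); reflexivity.
subst x'; split; trivial.
assert (Hy := proj2 (Hcup _ _ _ H y) (or_intror eq_refl)).
assert (Hy' := proj2 (Hcup _ _ _ H' y') (or_intror eq_refl)).
apply (Hcup _ _ _ H') in Hy; apply (Hcup _ _ _ H) in Hy'.
destruct Hy, Hy'; congruence.
Qed.

(** Replacement forms each row {x} x Y, replacement again collects the rows, and union joins them;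
    this avoids the power set. *)
Lemma product_exists X Y : exists p, is_product mem p X Y.
Proof.
assert (Hrow : forall x, exists r, forall z, mem z r <->
          exists y, mem y Y /\ is_opair mem z x y).
  intros x.
  destruct (@replacement (fun M mem e => is_opair mem (e 1) (e 2) (e 0))
              (def_opair 1 2 0) (x .: fun _ => x) Y) as [r Hr].
    intros u v w _; exact (@opair_unique v w x u).
  exists r; exact Hr.
destruct (@replacement (fun M mem e => forall z, mem z (e 1) <->
            exists y, mem y (e 2) /\ is_opair mem z (e 0) y) ltac:(def)
            (Y .: fun _ => Y) X) as [rows Hrows].
  intros x v w _ Hv Hw; apply (ax_extensionality ZF); intros z.
  specialize (Hv z); specialize (Hw z); simpl in Hv, Hw; rewrite Hv, Hw; tauto.
destruct (ax_union ZF rows) as [p Hp]; exists p; intros z; rewrite Hp; split.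
  intros (r & Hr & Hz); apply Hrows in Hr; destruct Hr as (x & Hx & Hr).
  apply Hr in Hz; destruct Hz as (y & Hy & Hz); exists x, y; auto.
intros (x & y & Hx & Hy & Hz); destruct (Hrow x) as [r Hr]; exists r; split.
  apply Hrows; exists x; auto.
apply Hr; exists y; auto.
Qed.

Lemma maps_to_pair h p x y : is_opair mem p x y -> maps_to mem h x y <-> mem p h.
Proof.
intros Hp; split.
  intros (q & Hq & Hqp); rewrite (opair_unique Hp Hqp); exact Hq.
intros H; exists p; auto.
Qed.

(** * Foundation, successors and the natural numbers of the model *)

Lemma mem_irrefl x : ~ mem x x.
Proof.
intros Hx; destruct (upair_exists x x) as [s Hs].
destruct (@ax_foundation M mem ZF s) as [y [Hy Hmin]].
  exists x; apply Hs; auto.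
apply Hs in Hy; assert (y = x) by tauto; subst y; exact (Hmin x Hx (proj2 (Hs x) (or_introl eq_refl))).
Qed.

Lemma empty_unique x y : is_empty mem x -> is_empty mem y -> x = y.
Proof.
intros Hx Hy; apply (ax_extensionality ZF); intros z; split; intros Hz;
  [case (Hx z Hz) | case (Hy z Hz)].
Qed.

Lemma succ_exists x : exists s, is_succ mem s x.
Proof.
destruct (upair_exists x x) as [d Hd], (upair_exists x d) as [p Hp].
destruct (ax_union ZF p) as [s Hs]; exists s; intros z; rewrite Hs; split.
  intros (w & Hw & Hz); apply Hp in Hw; destruct Hw as [-> | ->]; auto.
  right; apply Hd in Hz; tauto.
intros [Hz | ->]; [exists x | exists d]; split; trivial; try apply Hp; auto.
apply Hd; auto.
Qed.

Lemma succ_unique s s' x : is_succ mem s x -> is_succ mem s' x -> s = s'.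
Proof.
intros H H'; apply (ax_extensionality ZF); intros z; rewrite (H z), (H' z); tauto.
Qed.

Lemma mem_succ s x : is_succ mem s x -> mem x s.
Proof. intros H; apply H; auto. Qed.

Lemma nat_trans k i j : nat_ k -> mem j i -> mem i k -> mem j k.
Proof. intros [[H _] _] Hj Hi; exact (H i Hi j Hj). Qed.

Lemma mem_nat k i : nat_ k -> mem i k -> nat_ i.
Proof.
intros [[Ht Htt] Hn] Hi; repeat split.
- exact (Htt i Hi).
- intros y Hy; exact (Htt y (Ht i Hi y Hy)).
- intros m [Hm | ->]; apply Hn; left; [exact (Ht i Hi m Hm) | exact Hi].
Qed.

Lemma nat_empty o : is_empty mem o -> nat_ o.
Proof.
intros Ho; repeat split.
- intros y Hy; case (Ho y Hy).
- intros y Hy; case (Ho y Hy).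
- intros m [Hm | ->]; [case (Ho m Hm) | auto].
Qed.

Lemma nat_succ s k : nat_ k -> is_succ mem s k -> nat_ s.
Proof.
intros [[Ht Htt] Hn] Hs; repeat split.
- intros y Hy z Hz; apply Hs; left; apply Hs in Hy; destruct Hy as [Hy | ->]; trivial.
  exact (Ht y Hy z Hz).
- intros y Hy; apply Hs in Hy; destruct Hy as [Hy | ->]; auto.
- intros m [Hm | ->]; [apply Hn; apply Hs; exact Hm | right; exists k; exact Hs].
Qed.

Lemma nat_cases k : nat_ k -> is_empty mem k \/ exists j, nat_ j /\ is_succ mem k j.
Proof.
intros Hk; destruct (proj2 Hk k (or_intror eq_refl)) as [H | [j Hj]]; auto.
right; exists j; split; trivial; apply (mem_nat Hk), mem_succ, Hj.
Qed.

(** There may be no set of all naturals, so foundation is applied inside the successor of [k]. *)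
Lemma nat_least P (defP : definable P) (e : nat -> M) k :
  nat_ k -> P M mem (k .: e) ->
  exists m, nat_ m /\ P M mem (m .: e) /\ forall i, mem i m -> ~ P M mem (i .: e).
Proof.
intros Hk HP; destruct (succ_exists k) as [s Hs].
destruct (minimal_element defP (e := e) (X := s)) as (m & Hm & HPm & Hmin).
  exists k; split; trivial; exact (mem_succ Hs).
assert (Hns := nat_succ Hk Hs).
exists m; split; [exact (mem_nat Hns Hm) | split; trivial].
intros i Hi; apply Hmin; trivial; exact (nat_trans Hns Hi Hm).
Qed.

(** A least counterexample would be neither empty nor a successor. Since [P] has to be definable,
    each use packs its parameters into the valuation [e]. *)
Lemma nat_induction P (defP : definable P) (e : nat -> M) :
  (forall o, is_empty mem o -> P M mem (o .: e)) ->
  (forall k s, nat_ k -> is_succ mem s k -> P M mem (k .: e) -> P M mem (s .: e)) ->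
  forall k, nat_ k -> P M mem (k .: e).
Proof.
intros H0 HS k Hk; apply NNPP; intros HP.
destruct (nat_least (def_not defP) Hk HP) as (m & Hm & HPm & Hmin).
destruct (nat_cases Hm) as [Ho | (j & Hj & Hs)]; [exact (HPm (H0 m Ho)) |].
apply HPm; apply (HS j m Hj Hs); apply NNPP; exact (Hmin j (mem_succ Hs)).
Qed.

Lemma empty_mem_nat o k : is_empty mem o -> nat_ k -> k = o \/ mem o k.
Proof.
intros Ho.
apply (@nat_induction (fun M mem e => e 0 = e 1 \/ mem (e 1) (e 0)) ltac:(def)
         (o .: fun _ => o)); simpl.
  intros o' Ho'; left; exact (empty_unique Ho' Ho).
intros m s Hm Hs [-> | H]; right; apply Hs; auto.
Qed.

Lemma succ_mem_nat i s k :
  nat_ k -> is_succ mem s i -> mem i k -> s = k \/ mem s k.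
Proof.
intros Hk Hs; revert k Hk.
apply (@nat_induction (fun M mem e => mem (e 1) (e 0) -> e 2 = e 0 \/ mem (e 2) (e 0))
         ltac:(def) (i .: s .: fun _ => i)); simpl.
  intros o Ho Hi; case (Ho i Hi).
intros m t Hm Ht IH Hi; apply Ht in Hi; destruct Hi as [Hi | ->].
  right; apply Ht; destruct (IH Hi); auto.
left; exact (succ_unique Hs Ht).
Qed.

Lemma nat_trichotomy i k : nat_ i -> nat_ k -> mem i k \/ i = k \/ mem k i.
Proof.
intros Hi Hk; revert k Hk.
apply (@nat_induction (fun M mem e => mem (e 1) (e 0) \/ e 1 = e 0 \/ mem (e 0) (e 1))
         ltac:(def) (i .: fun _ => i)); simpl.
  intros o Ho; destruct (empty_mem_nat Ho Hi); auto.
intros m s Hm Hs [H | [-> | H]].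
- left; apply Hs; auto.
- left; apply Hs; auto.
- destruct (succ_mem_nat Hi Hs H); auto.
Qed.

(** * Recursion by computations inside the model *)

Section Iteration.

Variable next : M -> M -> M -> Prop.
Variables o x : M.
Hypothesis Ho : is_empty mem o.
Hypothesis next_fun : forall i u v w, next i u v -> next i u w -> v = w.

Lemma iter_zero : iter mem next o x o x.
Proof.
destruct (opair_exists o x) as [p Hp], (upair_exists p p) as [h Hh].
assert (Hin : forall i u, maps_to mem h i u <-> i = o /\ u = x).
  intros i u; split.
    intros (q & Hq & Hqp); apply Hh in Hq; assert (q = p) by tauto; subst q.
    exact (opair_inj Hqp Hp).
  intros [-> ->]; apply (maps_to_pair h Hp); apply Hh; auto.
exists h; split; [|apply Hin; auto].
split; [apply Hin; auto | split; [|split]].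
- intros i u H; apply Hin in H; tauto.
- intros i u v Hu Hv; apply Hin in Hu; apply Hin in Hv; destruct Hu, Hv; congruence.
- intros i Hi; case (Ho Hi).
Qed.

(** The pair (s, z) is adjoined to the computation. It stays functional because [run] confines its
    domain to the stages up to [k], and [s] is not one of them. *)
Lemma iter_succ k s y z : nat_ k -> is_succ mem s k ->
  iter mem next o x k y -> next k y z -> iter mem next o x s z.
Proof.
intros Hk Hs (h & (H0 & Hdom & Hfun & Hstep) & Hy) Hz.
destruct (opair_exists s z) as [p Hp], (upair_exists p p) as [d Hd].
destruct (upair_exists h d) as [hd Hhd], (ax_union ZF hd) as [h' Hh'].
assert (Hin : forall i u, maps_to mem h' i u <-> maps_to mem h i u \/ i = s /\ u = z).
  intros i u; split.
    intros (q & Hq & Hqp); apply Hh' in Hq; destruct Hq as (w & Hw & Hq).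
    apply Hhd in Hw; destruct Hw as [-> | ->]; [left; exists q; auto |].
    apply Hd in Hq; assert (q = p) by tauto; subst q; right; exact (opair_inj Hqp Hp).
  intros [(q & Hq & Hqp) | [-> ->]].
    exists q; split; trivial; apply Hh'; exists h; split; trivial; apply Hhd; auto.
  exists p; split; trivial; apply Hh'; exists d; split; [apply Hhd | apply Hd]; auto.
assert (Hns : forall u, ~ maps_to mem h s u).
  intros u Hu; apply Hdom in Hu; destruct Hu as [Hu | Hu].
    exact (mem_irrefl (nat_trans Hk (mem_succ Hs) Hu)).
  apply mem_succ in Hs; rewrite Hu in Hs; exact (mem_irrefl Hs).
exists h'; split; [|apply Hin; auto].
split; [apply Hin; auto | split; [|split]].
- intros i u H; apply Hin in H; destruct H as [H | [-> _]]; auto.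
  left; apply Hs; exact (Hdom i u H).
- intros i u v Hu Hv; apply Hin in Hu; apply Hin in Hv.
  destruct Hu as [Hu | [-> ->]], Hv as [Hv | [E ->]]; trivial.
  + exact (Hfun i u v Hu Hv).
  + subst i; case (Hns u Hu).
  + case (Hns v Hv).
- intros i Hi; apply Hs in Hi; destruct Hi as [Hi | ->].
    destruct (Hstep i Hi) as (t & u & v & Ht & Hu & Hv & Hn).
    exists t, u, v; repeat split; trivial; try apply Ht; apply Hin; auto.
  exists s, y, z; repeat split; trivial; try apply Hs; apply Hin; auto.
Qed.

(** Two computations agree at every stage up to [k], by induction on the stage. The induction
    predicate speaks only of the sets [h] and [h'], so it is definable whatever [next] is. *)
Lemma iter_unique k y z : nat_ k ->
  iter mem next o x k y -> iter mem next o x k z -> y = z.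
Proof.
intros Hk (h & (H0 & _ & Hfun & Hstep) & Hy) (h' & (H0' & _ & Hfun' & Hstep') & Hz).
assert (Hagree : forall i, nat_ i -> mem i k \/ i = k ->
          forall u v, maps_to mem h i u -> maps_to mem h' i v -> u = v).
  apply (@nat_induction (fun M mem e => mem (e 0) (e 1) \/ e 0 = e 1 ->
           forall u v, maps_to mem (e 2) (e 0) u -> maps_to mem (e 3) (e 0) v -> u = v)
           ltac:(def) (k .: h .: h' .: fun _ => k)); simpl.
    intros o' Ho' _ u v Hu Hv; rewrite (empty_unique Ho' Ho) in Hu, Hv.
    rewrite (Hfun _ _ _ Hu H0), (Hfun' _ _ _ Hv H0'); reflexivity.
  intros i s Hi Hs IH Hsk u v Hu Hv.
  assert (Hik : mem i k).
    destruct Hsk as [Hsk | <-]; [exact (nat_trans Hk (mem_succ Hs) Hsk) | exact (mem_succ Hs)].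
  destruct (Hstep i Hik) as (t & a & b & Ht & Ha & Hb & Hab).
  destruct (Hstep' i Hik) as (t' & a' & b' & Ht' & Ha' & Hb' & Hab').
  rewrite (succ_unique Ht Hs) in Hb; rewrite (succ_unique Ht' Hs) in Hb'.
  rewrite <- (IH (or_introl Hik) a a' Ha Ha') in Hab'.
  rewrite (Hfun _ _ _ Hu Hb), (Hfun' _ _ _ Hv Hb'); exact (next_fun Hab Hab').
exact (Hagree k Hk (or_intror eq_refl) y z Hy Hz).
Qed.

End Iteration.

Section Division.

Variables n A B o : M.
Hypotheses (Hn : is_natural mem n) (Ho : is_empty mem o) (Hon : mem o n).

Notation placement := (placement mem n A B).

(** * First half of a round: exchanging places within each hand *)

Section Shape.

Variable R : M -> M -> M -> M -> Prop.
Hypothesis HR : placement R.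

Lemma lead_unique b l l' : lead mem R o b l -> lead mem R o b l' -> l = l'.
Proof.
intros [[a Ha] H] [[a' Ha'] H'].
assert (Hl := pl_range HR Ha); assert (Hl' := pl_range HR Ha').
destruct (@nat_trichotomy l l') as [E | [E | E]]; trivial.
- apply (mem_nat Hn); tauto.
- apply (mem_nat Hn); tauto.
- case (H' l E a Ha).
- case (H l' E a' Ha').
Qed.

(** As the lead of a hand is unique, [R] is composed with an involution of the places of each
    hand. *)
Lemma placement_shape : placement (shape mem R o).
Proof.
split.
- intros i a j b (j0 & Hj0 & H); apply (pl_range HR) in Hj0.
  destruct H as [[_ ->] | [(_ & _ & [[a' Ha'] _]) | (_ & _ & ->)]]; try tauto.
  apply (pl_range HR) in Ha'; tauto.
- intros i a Hi Ha; destruct (pl_total HR Hi Ha) as (j & b & H).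
  destruct (classic (lead mem R o b j)); [exists o, b, j; auto |].
  destruct (classic (j = o /\ exists l, lead mem R o b l)) as [[-> [l Hl]] | Hj].
    exists l, b, o; split; trivial; right; left; auto.
  exists j, b, j; split; trivial; right; right; repeat split; trivial.
  intros E l Hl; apply Hj; split; trivial; exists l; exact Hl.
- intros i a j b j' b' (l & Hl & H) (l' & Hl' & H').
  destruct (pl_fun HR Hl Hl') as [<- <-]; split; trivial.
  destruct H as [[L ->] | [(L & E & L1) | (L & L1 & ->)]],
    H' as [[K ->] | [(K & E' & K1) | (K & K1 & ->)]]; trivial; try tauto.
  + exact (lead_unique L1 K1).
  + case (K1 E j L1).
  + case (L1 E' j' K1).
- intros i a i' a' j b (l & Hl & H) (l' & Hl' & H').
  assert (E : l = l').
  { destruct H as [[L E] | [(L & E & L1) | (L & L1 & E)]],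
      H' as [[K E'] | [(K & E' & K1) | (K & K1 & E')]]; subst; trivial; try tauto.
    * exact (lead_unique L K).
    * case (K1 eq_refl l L).
    * case (L1 eq_refl l' K). }
  subst l'; exact (pl_inj HR Hl Hl').
Qed.

Lemma lead_stays k b : R o k o b -> lead mem R o b o.
Proof. intros H; split; [exists k; exact H | intros l Hl; case (Ho Hl)]. Qed.

(** The lead of [b] is already place [o], so the exchange in this hand is trivial. *)
Lemma shape_stays i j k b : R o k o b -> R i k j b -> shape mem R o i k j b.
Proof.
intros H0 H; assert (L := lead_stays H0); exists j; split; trivial.
destruct (classic (lead mem R o b j)) as [Lj | Lj].
  left; split; trivial; exact (lead_unique Lj L).
right; right; repeat split; trivial; intros ->; case (Lj L).
Qed.

End Shape.

(** * Second half of a round: exchanging spades with the cards they visit *)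

Section Ship.

Variable R : M -> M -> M -> M -> Prop.
Hypothesis HR : placement R.

Lemma visits_fun q j k j' k' : visits R o q j k -> visits R o q j' k' -> j = j' /\ k = k'.
Proof.
intros (_ & b & H1 & H2) (_ & b' & H1' & H2').
destruct (pl_fun HR H1 H1') as [<- <-]; split; trivial; apply (pl_inj HR H2 H2').
Qed.

Lemma visits_inj q q' j k : visits R o q j k -> visits R o q' j k -> q = q'.
Proof.
intros (_ & b & H1 & H2) (_ & b' & H1' & H2').
destruct (pl_fun HR H2 H2') as [_ <-]; apply (pl_inj HR H1 H1').
Qed.

Lemma anchor_no_visits q b : R o q o b -> ~ exists j k, visits R o q j k.
Proof.
intros H (j & k & Hj & b' & H' & _); apply Hj; symmetry; apply (pl_fun HR H H').
Qed.

(** The exchanged pairs (o, q), (j, k) are disjoint: visitor and visited card determine each other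
    by [visits_fun] and [visits_inj], and a visited card is not a spade. *)
Lemma placement_ship : placement (ship R o).
Proof.
split.
- intros i a j b [(-> & j0 & k & (_ & b0 & H1 & H2) & H) |
    [(q & (_ & b0 & H1 & H2) & H) | (_ & _ & H)]].
  + apply (pl_range HR) in H; apply (pl_range HR) in H1; tauto.
  + apply (pl_range HR) in H; apply (pl_range HR) in H1; apply (pl_range HR) in H2; tauto.
  + exact (pl_range HR H).
- intros i a Hi Ha.
  destruct (classic (i = o /\ exists j0 k, visits R o a j0 k)) as [[-> (j & k & H)] | H1].
    destruct H as (Hj & b & H1 & H2).
    destruct (pl_range HR H1) as (_ & _ & Hjn & _), (pl_range HR H2) as (_ & Hk & _).
    destruct (pl_total HR Hjn Hk) as (j' & b' & H'); exists j', b'; left.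
    split; trivial; exists j, k; split; trivial; split; trivial; exists b; auto.
  destruct (classic (exists q, visits R o q i a)) as [[q H] | H2].
    destruct (H) as (_ & b & H' & _); exists i, b; right; left; exists q; auto.
  destruct (pl_total HR Hi Ha) as (j & b & H); exists j, b; right; right; auto.
- intros i a j b j' b' H H'.
  destruct H as [(E & l & k & V & H) | [(q & V & H) | (N1 & N2 & H)]],
    H' as [(E' & l' & k' & V' & H') | [(q' & V' & H') | (N1' & N2' & H')]].
  + destruct (visits_fun V V') as [<- <-]; exact (pl_fun HR H H').
  + case (proj1 V' E).
  + case N1'; eauto.
  + case (proj1 V E').
  + rewrite <- (visits_inj V V') in H'; exact (pl_fun HR H H').
  + case N2'; eauto.
  + case N1; eauto.
  + case N2; eauto.
  + exact (pl_fun HR H H').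
- intros i a i' a' j b H H'.
  destruct H as [(-> & l & k & V & H) | [(q & V & H) | (N1 & N2 & H)]],
    H' as [(-> & l' & k' & V' & H') | [(q' & V' & H') | (N1' & N2' & H')]].
  + destruct (pl_inj HR H H') as [<- <-]; split; trivial; exact (visits_inj V V').
  + destruct (pl_inj HR H H') as [E _]; case (proj1 V E).
  + destruct (pl_inj HR H H') as [<- <-]; case N2'; eauto.
  + destruct (pl_inj HR H H') as [E _]; case (proj1 V' (eq_sym E)).
  + destruct (pl_inj HR H H') as [_ <-]; exact (visits_fun V V').
  + destruct (pl_inj HR H H') as [<- <-]; case N1'; eauto.
  + destruct (pl_inj HR H H') as [<- <-]; case N2; eauto.
  + destruct (pl_inj HR H H') as [-> ->]; case N1; eauto.
  + exact (pl_inj HR H H').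
Qed.

(** A visitor of (j, k) would lie in place [j] of the hand of [b], which (j, k) itself occupies;
    then j = o, against [visits]. *)
Lemma ship_stays k j b : R o k o b -> R j k j b -> ship R o j k j b.
Proof.
intros H0 H; right; right; repeat split; trivial.
  intros [_ N]; exact (anchor_no_visits H0 N).
intros (q & Hj & b' & H1 & H2); apply Hj.
destruct (pl_fun HR H0 H2) as [_ <-]; apply (pl_inj HR H H1).
Qed.

(** The visited card takes the position of its visitor, which is place [j] beside the spade of
    [k]. *)
Lemma ship_visits q j k : visits R o q j k ->
  exists b, ship R o o k o b /\ ship R o j k j b.
Proof.
intros V; destruct (V) as (Hj & b & H1 & H2); exists b; split.
  apply ship_stays; auto.
right; left; exists q; auto.
Qed.

End Ship.

(** * Rounds as operations on sets of the model *)

Lemma places_pair F i a j b c p z :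
  is_opair mem c i a -> is_opair mem p j b -> is_opair mem z c p ->
  (places mem F i a j b <-> mem z F).
Proof.
intros Hc Hp Hz; rewrite <- (maps_to_pair F Hz); split.
  intros (c' & p' & Hc' & Hp' & H).
  rewrite (opair_unique Hc Hc'), (opair_unique Hp Hp'); exact H.
intros H; exists c, p; auto.
Qed.

(** Both halves preserve placements, so the new deal can be separated from (n x A) x (n x B). *)
Lemma round_exists F : placement (places mem F) -> exists F', round mem o F F'.
Proof.
intros HF; assert (HS := placement_ship (placement_shape HF)).
destruct (product_exists n A) as [nA HnA], (product_exists n B) as [nB HnB].
destruct (product_exists nA nB) as [X HX].
destruct (@separation (fun M mem e => exists i a j b c p,
            is_opair mem c i a /\ is_opair mem p j b /\ is_opair mem (e 0) c p /\
            ship (shape mem (places mem (e 1)) (e 2)) (e 2) i a j b)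
            ltac:(unfold ship; def) (F .: o .: fun _ => o) X) as [F' HF'].
simpl in HF'; exists F'; intros z; rewrite HF'; split; [tauto | intros H; split; trivial].
destruct H as (i & a & j & b & c & p & Hc & Hp & Hz & H).
destruct (pl_range HS H) as (Hi & Ha & Hj & Hb).
apply HX; exists c, p; repeat split; trivial;
  [apply HnA; exists i, a | apply HnB; exists j, b]; auto.
Qed.

Lemma round_unique F F1 F2 : round mem o F F1 -> round mem o F F2 -> F1 = F2.
Proof.
intros H1 H2; apply (ax_extensionality ZF); intros z; rewrite (H1 z), (H2 z); tauto.
Qed.

Lemma round_places F F' i a j b : round mem o F F' ->
  (places mem F' i a j b <-> ship (shape mem (places mem F) o) o i a j b).
Proof.
intros HF; destruct (opair_exists i a) as [c Hc], (opair_exists j b) as [p Hp].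
destruct (opair_exists c p) as [z Hz]; rewrite (places_pair F' Hc Hp Hz), (HF z); split.
  intros (i' & a' & j' & b' & c' & p' & Hc' & Hp' & Hz' & H).
  destruct (opair_inj Hz Hz') as [<- <-], (opair_inj Hc Hc') as [<- <-].
  destruct (opair_inj Hp Hp') as [<- <-]; exact H.
intros H; exists i, a, j, b, c, p; auto.
Qed.

Lemma round_placement F F' :
  round mem o F F' -> placement (places mem F) -> placement (places mem F').
Proof.
intros Hr HF; destruct (placement_ship (placement_shape HF)) as [H1 H2 H3 H4]; split.
- intros i a j b H; apply (round_places _ _ _ _ Hr) in H; exact (H1 _ _ _ _ H).
- intros i a Hi Ha; destruct (H2 i a Hi Ha) as (j & b & H); exists j, b.
  apply (round_places _ _ _ _ Hr); exact H.
- intros i a j b j' b' H H'; apply (round_places _ _ _ _ Hr) in H, H'.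
  exact (H3 _ _ _ _ _ _ H H').
- intros i a i' a' j b H H'; apply (round_places _ _ _ _ Hr) in H, H'.
  exact (H4 _ _ _ _ _ _ H H').
Qed.

Lemma row_lead F q j b : placement (places mem F) -> places mem F o q j b ->
  exists l, lead mem (places mem F) o b l.
Proof.
intros HF H.
destruct (@minimal_element (fun M mem e =>
            exists a, places mem (e 1) (e 2) a (e 0) (e 3)) ltac:(def)
            (F .: o .: b .: fun _ => o) n) as (l & Hl & Ha & Hmin); simpl in *.
  exists j; split; [apply (pl_range HF H) | exists q; exact H].
exists l; split; trivial; intros l' Hl' a Ha'.
apply (Hmin l'); [apply (pl_range HF Ha') | exact Hl' | exists a; exact Ha'].
Qed.

(** * States of the game and settled ranks *)

Section Game.

Variable f : M.
Hypothesis Hf : placement (places mem f).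

Notation state := (state mem o f).
Notation visit := (visit mem o f).
Notation settled_at := (settled_at mem o f).
Notation settled := (settled mem o f).
Notation runaway := (runaway mem o A f).
Notation unbounded := (unbounded mem o f).
Notation column := (column mem o A f).
Notation hop := (hop mem o A f).
Notation move := (move mem o A f).

Lemma state_unique t F F' : state t F -> state t F' -> F = F'.
Proof.
intros [Ht H] [_ H']; apply (iter_unique Ho (fun i => @round_unique) Ht H H').
Qed.

Lemma state_succ t s F F' : is_succ mem s t -> state t F -> round mem o F F' -> state s F'.
Proof.
intros Hs [Ht H] Hr; split; [exact (nat_succ Ht Hs) | exact (iter_succ Ht Hs H Hr)].
Qed.

(** The induction carries [placement] along, because [round_exists] asks for it at each step. *)
Lemma state_exists t : is_natural mem t ->
  exists F, state t F /\ placement (places mem F).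
Proof.
revert t; apply (@nat_induction (fun M mem e => exists F,
    Submission.state mem (e 1) (e 2) (e 0) F /\
    Submission.placement mem (e 3) (e 4) (e 5) (places mem F)) ltac:(def)
    (o .: f .: n .: A .: B .: fun _ => o)); simpl.
  intros o' Ho'; rewrite (empty_unique Ho' Ho); exists f; split; trivial.
  split; [exact (nat_empty Ho) | exact (iter_zero _ _ Ho)].
intros k s Hk Hs (F & H & HF); destruct (round_exists HF) as [F' Hr].
exists F'; split; [exact (state_succ Hs H Hr) | exact (round_placement Hr HF)].
Qed.

Lemma state_placement t F : state t F -> placement (places mem F).
Proof.
intros H; destruct (state_exists (proj1 H)) as (F' & H' & HF').
rewrite (state_unique H H'); exact HF'.
Qed.

(** Beside its own spade in place [o], the card (j, k) is fixed by both halves of every later round,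
    by [shape_stays] and [ship_stays]. For j = o this says that a settled spade stays. *)
Lemma state_keeps t F k j b : state t F -> places mem F o k o b -> places mem F j k j b ->
  forall t' F', mem t t' \/ t = t' -> state t' F' ->
    places mem F' o k o b /\ places mem F' j k j b.
Proof.
intros H H0 Hj.
assert (Hkeep : forall t', is_natural mem t' -> mem t t' \/ t = t' ->
  exists F', state t' F' /\ places mem F' o k o b /\ places mem F' j k j b).
  apply (@nat_induction (fun M mem e => mem (e 1) (e 0) \/ e 1 = e 0 ->
    exists F', Submission.state mem (e 2) (e 3) (e 0) F' /\
      places mem F' (e 2) (e 4) (e 2) (e 6) /\ places mem F' (e 5) (e 4) (e 5) (e 6))
    ltac:(def) (t .: o .: f .: k .: j .: b .: fun _ => o)); simpl.
    intros o' Ho' [Ht | <-]; [case (Ho' t Ht) | exists F; auto].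
  intros m s Hm Hs IH [Ht | <-]; [| exists F; auto].
  destruct IH as (F' & H' & H0' & Hj'); [apply Hs; exact Ht |].
  assert (HF' := state_placement H'); destruct (round_exists HF') as [F'' Hr].
  assert (HS := placement_shape HF').
  assert (S0 := shape_stays HF' H0' H0'); assert (Sj := shape_stays HF' H0' Hj').
  exists F''; split; [exact (state_succ Hs H' Hr) |].
  split; apply (round_places _ _ _ _ Hr); apply (ship_stays HS S0); trivial.
intros t' F' Ht H'; destruct (Hkeep t' (proj1 H') Ht) as (F'' & H'' & K).
rewrite (state_unique H' H''); exact K.
Qed.

(** At the later of the two times both spades are in place. *)
Lemma settled_common k b k' b' : settled k b -> settled k' b' ->
  exists F, placement (places mem F) /\ places mem F o k o b /\ places mem F o k' o b'.
Proof.
intros (t & F & H & Hk) (t' & F' & H' & Hk').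
assert (K := state_keeps H Hk Hk); assert (K' := state_keeps H' Hk' Hk').
destruct (nat_trichotomy (proj1 H) (proj1 H')) as [E | [E | E]].
- exists F'; split; [exact (state_placement H') |]; split; trivial; apply (K t' F'); auto.
- exists F'; split; [exact (state_placement H') |]; split; trivial; apply (K t' F'); auto.
- exists F; split; [exact (state_placement H) |]; split; trivial; apply (K' t F); auto.
Qed.

Lemma settled_fun k b b' : settled k b -> settled k b' -> b = b'.
Proof. intros H H'; destruct (settled_common H H') as (F & HF & K & K'); apply (pl_fun HF K K'). Qed.

Lemma settled_inj k k' b : settled k b -> settled k' b -> k = k'.
Proof. intros H H'; destruct (settled_common H H') as (F & HF & K & K'); apply (pl_inj HF K K'). Qed.

Lemma settled_row k b : settled k b -> mem b B.
Proof. intros H; destruct (settled_common H H) as (F & HF & K & _); apply (pl_range HF K). Qed.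

(** * Visits and their uniqueness *)

Lemma visit_range t q j k : visit t q j k ->
  is_natural mem t /\ mem j n /\ mem k A.
Proof.
intros (F & H & _ & b & H1 & H2); assert (HS := placement_shape (state_placement H)).
split; [exact (proj1 H) |].
split; [apply (pl_range HS H1) | apply (pl_range HS H2)].
Qed.

Lemma visit_keeps t q j k : visit t q j k ->
  exists b, forall t' F', mem t t' -> state t' F' ->
    places mem F' o k o b /\ places mem F' j k j b.
Proof.
intros (F & H & V); assert (HF := state_placement H).
destruct (round_exists HF) as [F' Hr], (succ_exists t) as [s Hs].
destruct (ship_visits (placement_shape HF) V) as (b & H0 & Hj).
apply (round_places _ _ _ _ Hr) in H0, Hj.
assert (H' := state_succ Hs H Hr); exists b; intros t' F'' Ht H''.
apply (state_keeps H' H0 Hj (t' := t')); trivial.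
destruct (succ_mem_nat (proj1 H'') Hs Ht); auto.
Qed.

Lemma visit_settled t q j k : visit t q j k -> exists b, settled k b.
Proof.
intros V; destruct (visit_keeps V) as [b K]; exists b.
(* The spade of [k] may have reached place [o] only within round [t], so the state after that round
   is taken. *)
destruct (succ_exists t) as [s Hs].
destruct (state_exists (t := s)) as (F & H & _).
  apply (nat_succ (k := t)); trivial; apply (visit_range V).
exists s, F; split; trivial; apply (K s F (mem_succ Hs) H).
Qed.

(** After the first visit (j, k) occupies place [j] beside its spade for good, so a later visiting
    spade would be that very card, although j <> o. *)
Lemma visit_once t t' q q' j k : visit t q j k -> visit t' q' j k -> ~ mem t t'.
Proof.
intros V (F & H & Hj & b' & H1 & H2) Ht; destruct (visit_keeps V) as [b K].
destruct (K t' F Ht H) as [K0 Kj]; assert (HF := state_placement H).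
assert (HS := placement_shape HF).
destruct (pl_fun HS (shape_stays HF K0 K0) H2) as [_ <-].
apply Hj; apply (pl_inj HS (shape_stays HF K0 Kj) H1).
Qed.

Lemma visit_inj t t' q q' j k : visit t q j k -> visit t' q' j k -> t = t' /\ q = q'.
Proof.
intros V V'.
destruct (nat_trichotomy (proj1 (visit_range V)) (proj1 (visit_range V'))) as [E | [<- | E]].
- case (visit_once V V' E).
- split; trivial; destruct V as (F & H & V), V' as (F' & H' & V').
  rewrite <- (state_unique H H') in V'.
  exact (visits_inj (placement_shape (state_placement H)) V V').
- case (visit_once V' V E).
Qed.

Lemma visit_fun t q j j' k k' : visit t q j k -> visit t q j' k' -> j = j' /\ k = k'.
Proof.
intros (F & H & V) (F' & H' & V'); rewrite <- (state_unique H H') in V'.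
exact (visits_fun (placement_shape (state_placement H)) V V').
Qed.

(** * Runaways and the suits they visit unboundedly often *)

Lemma runaway_visit w t : runaway w -> is_natural mem t -> exists j k, visit t w j k.
Proof.
intros [Hw Hrun] Ht; destruct (state_exists Ht) as (F & H & HF).
assert (HS := placement_shape HF); destruct (pl_total HS Hon Hw) as (j & b & Hj).
destruct (classic (j = o)) as [-> | Hjo].
  (* A spade in place [o] after [shape] is left there by [ship], so [w] would be settled in the next
     state. *)
  destruct (round_exists HF) as [F' Hr], (succ_exists t) as [s Hs].
  case (Hrun b); exists s, F'; split; [exact (state_succ Hs H Hr) |].
  apply (round_places _ _ _ _ Hr); exact (ship_stays HS Hj Hj).
(* [shape] acts within hands, so [b] held a spade before it and has a lead; that lead is now in
   place [o] and its rank is the one visited. *)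
destruct Hj as (j0 & Hj0 & Hj); destruct (row_lead HF Hj0) as (l & L).
destruct (proj1 L) as [k Hk]; exists j, k, F; split; trivial; split; trivial.
exists b; split; [exists j0; auto | exists l; auto].
Qed.

(** Pigeonhole: otherwise the visits in each suit are bounded in time, and taking the larger of two
    bounds, suit by suit, gives one bound [T] for all suits below n. But [runaway_visit] yields a
    visit right after [T]. *)
Lemma runaway_unbounded w : runaway w -> exists j, mem j n /\ unbounded w j.
Proof.
intros Hw; apply NNPP; intros Hnone.
assert (Hbound : forall m, is_natural mem m -> mem m n \/ m = n ->
  exists T, is_natural mem T /\
    forall t, mem T t -> forall j, mem j m -> forall k, ~ visit t w j k).
  apply (@nat_induction (fun M mem e => mem (e 0) (e 1) \/ e 0 = e 1 ->
    exists T, is_natural mem T /\ forall t, mem T t -> forall j, mem j (e 0) ->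
      forall k, ~ Submission.visit mem (e 2) (e 3) t (e 4) j k) ltac:(def)
    (n .: o .: f .: w .: fun _ => o)); simpl.
    intros o' Ho' _; exists o; split; [exact (nat_empty Ho) |].
    intros t _ j Hj; case (Ho' j Hj).
  intros m s Hm Hs IH Hsn.
  assert (Hmn : mem m n).
    destruct Hsn as [H | <-]; [exact (nat_trans Hn (mem_succ Hs) H) | exact (mem_succ Hs)].
  destruct (IH (or_introl Hmn)) as (T & HT & Hlow).
  assert (Htop : exists T', is_natural mem T' /\
            forall t, mem T' t -> forall k, ~ visit t w m k).
    apply NNPP; intros H; apply Hnone; exists m; split; trivial.
    intros t Ht; apply NNPP; intros H'; apply H; exists t; split; trivial.
    intros t' Htt' k V; apply H'; exists t', k; auto.
  destruct Htop as (T' & HT' & Htop).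
  destruct (nat_trichotomy HT HT') as [E | E].
    exists T'; split; trivial; intros t Ht j Hj k V; apply Hs in Hj.
    destruct Hj as [Hj | ->]; [| exact (Htop t Ht k V)].
    refine (Hlow t _ j Hj k V).
    exact (nat_trans (proj1 (visit_range V)) E Ht).
  exists T; split; trivial; intros t Ht j Hj k V; apply Hs in Hj.
  destruct Hj as [Hj | ->]; [exact (Hlow t Ht j Hj k V) |].
  refine (Htop t _ k V); destruct E as [<- | E]; trivial.
  exact (nat_trans (proj1 (visit_range V)) E Ht).
destruct (Hbound n Hn (or_intror eq_refl)) as (T & HT & H).
destruct (succ_exists T) as [t Ht].
destruct (runaway_visit Hw (nat_succ HT Ht)) as (j & k & V).
exact (H t (mem_succ Ht) j (proj1 (proj2 (visit_range V))) k V).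
Qed.

Lemma runaway_column w : runaway w -> exists j, mem j n /\ column w j.
Proof.
intros Hw.
destruct (@minimal_element (fun M mem e =>
            Submission.unbounded mem (e 1) (e 2) (e 3) (e 0)) ltac:(def)
            (o .: f .: w .: fun _ => o) n (runaway_unbounded Hw))
  as (j & Hj & Hu & Hmin); simpl in *.
exists j; split; trivial; split; trivial; split; trivial.
intros i Hi; apply Hmin; trivial; exact (nat_trans Hn Hi Hj).
Qed.

Lemma first_visit_after t w j : unbounded w j -> is_natural mem t ->
  exists t' k, mem t t' /\ visit t' w j k /\
    forall s, mem t s -> mem s t' -> forall k', ~ visit s w j k'.
Proof.
intros Hu Ht; destruct (Hu t Ht) as (t0 & k0 & Ht0 & V0).
destruct (@nat_least (fun M mem e => mem (e 1) (e 0) /\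
            exists k, Submission.visit mem (e 2) (e 3) (e 0) (e 4) (e 5) k) ltac:(def)
            (t .: o .: f .: w .: j .: fun _ => o) t0) as (t' & _ & (Htt' & k & V) & Hmin);
  simpl in *.
- apply (visit_range V0).
- split; trivial; exists k0; exact V0.
- exists t', k; repeat split; trivial; intros s Hs Hst' k' V'.
  apply (Hmin s Hst'); split; trivial; exists k'; exact V'.
Qed.

(** Unlike [first_visit_after] started at time [o], this also counts a visit at time [o] itself. *)
Lemma first_visit w j : unbounded w j ->
  exists t k, visit t w j k /\ forall s, mem s t -> forall k', ~ visit s w j k'.
Proof.
intros Hu; destruct (Hu o (nat_empty Ho)) as (t0 & k0 & Ht0 & V0).
destruct (@nat_least (fun M mem e =>
            exists k, Submission.visit mem (e 1) (e 2) (e 0) (e 3) (e 4) k) ltac:(def)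
            (o .: f .: w .: j .: fun _ => o) t0) as (t & _ & (k & V) & Hmin);
  simpl in *.
- apply (visit_range V0).
- exists k0; exact V0.
- exists t, k; split; trivial; intros s Hst k' V'; apply (Hmin s Hst); exists k'; exact V'.
Qed.

Lemma visit_time_eq t t' w w' j k k' : visit t w j k -> visit t' w' j k' ->
  ~ mem t t' -> ~ mem t' t -> t = t'.
Proof.
intros V V' N N'.
destruct (nat_trichotomy (proj1 (visit_range V)) (proj1 (visit_range V'))) as [E | [E | E]];
  tauto.
Qed.

(** * Hops and moves in the hotel of one suit *)

Lemma visited_not_runaway t w j k : visit t w j k -> ~ runaway k.
Proof. intros V [_ H]; destruct (visit_settled V) as [b Hb]; exact (H b Hb). Qed.

(** The two kinds of hop have different sources, as a runaway is never visited. For a visited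
    source, [visit_inj] recovers the visitor and the time, and the next visit in suit [j] is
    unique. *)
Lemma hop_fun j x y y' : hop j x y -> hop j x y' -> y = y'.
Proof.
intros [(C & t & V & N) | (w & s & t & C & Hst & V0 & V & N)]
  [(C' & t' & V' & N') | (w' & s' & t' & C' & Hst' & V0' & V' & N')].
- assert (t = t') as <-.
    apply (visit_time_eq V V'); intros E; [exact (N' t E y V) | exact (N t' E y' V')].
  apply (visit_fun V V').
- case (visited_not_runaway V0' (proj1 C)).
- case (visited_not_runaway V0 (proj1 C')).
- destruct (visit_inj V0 V0') as [<- <-].
  assert (t = t') as <-.
    apply (visit_time_eq V V'); intros E;
      [exact (N' t Hst E y V) | exact (N t' Hst' E y' V')].
  apply (visit_fun V V').
Qed.

(** By [visit_inj], [y] determines its visitor and the time. The source is the visitor itself if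
    this is its first visit in suit [j], and otherwise the rank of its preceding visit in suit
    [j]. *)
Lemma hop_inj j x x' y : hop j x y -> hop j x' y -> x = x'.
Proof.
intros [(C & t & V & N) | (w & s & t & C & Hst & V0 & V & N)]
  [(C' & t' & V' & N') | (w' & s' & t' & C' & Hst' & V0' & V' & N')];
  destruct (visit_inj V V') as [<- <-]; trivial.
- case (N s' Hst' x' V0').
- case (N' s Hst x V0).
- assert (s = s') as <-.
    apply (visit_time_eq V0 V0'); intros E;
      [exact (N s' E Hst' x' V0') | exact (N' s E Hst x V0)].
  apply (visit_fun V0 V0').
Qed.

Lemma hop_visit j x y : hop j x y -> exists w t, column w j /\ visit t w j y.
Proof.
intros [(C & t & V & _) | (w & s & t & C & _ & _ & V & _)];
  [exists x, t | exists w, t]; auto.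
Qed.

(* A rank hopped to hops itself, which keeps [move] injective. *)
Lemma hop_continues j x y : hop j x y -> exists z, hop j y z.
Proof.
intros H; destruct (hop_visit H) as (w & t & C & V).
destruct (first_visit_after (proj1 (proj2 C)) (proj1 (visit_range V)))
  as (t' & z & Ht & V' & N).
exists z; right; exists w, t, t'; auto 7.
Qed.

Lemma column_hop j w : column w j -> exists y, hop j w y.
Proof.
intros C; destruct (first_visit (proj1 (proj2 C))) as (t & y & V & N).
exists y; left; split; trivial; exists t; auto.
Qed.

Lemma hop_target j x y : hop j x y -> mem y A /\ ~ runaway y.
Proof.
intros H; destruct (hop_visit H) as (w & t & _ & V).
split; [apply (visit_range V) | exact (visited_not_runaway V)].
Qed.

Lemma move_fun j x y y' : move j x y -> move j x y' -> y = y'.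
Proof.
intros [H | [N ->]] [H' | [N' ->]]; trivial.
- exact (hop_fun H H').
- case (N' y H).
- case (N y' H').
Qed.

Lemma move_inj j x x' y : move j x y -> move j x' y -> x = x'.
Proof.
intros [H | [N E]] [H' | [N' E']].
- exact (hop_inj H H').
- subst y; destruct (hop_continues H) as [z Hz]; case (N' z Hz).
- subst y; destruct (hop_continues H') as [z Hz]; case (N z Hz).
- congruence.
Qed.

Lemma move_total j x : mem x A -> exists y, mem y A /\ move j x y.
Proof.
intros Hx; destruct (classic (exists y, hop j x y)) as [[y H] | N].
  exists y; split; [apply (hop_target H) | left; exact H].
exists x; split; trivial; right; split; trivial; intros z H; apply N; exists z; exact H.
Qed.

(** * Running through the hotels of all suits *)

Notation moves := (iter mem move o).

Lemma moves_total k x : is_natural mem k -> mem x A -> exists y, mem y A /\ moves x k y.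
Proof.
intros Hk Hx; revert k Hk.
apply (@nat_induction (fun M mem e => exists y, mem y (e 1) /\
    iter mem (Submission.move mem (e 2) (e 1) (e 3)) (e 2) (e 4) (e 0) y) ltac:(def)
    (A .: o .: f .: x .: fun _ => o)); simpl.
  intros o' Ho'; rewrite (empty_unique Ho' Ho); exists x; split; trivial.
  exact (iter_zero _ _ Ho).
intros k s Hk Hs (y & Hy & H); destruct (move_total k Hy) as (z & Hz & Hm).
exists z; split; trivial; exact (iter_succ Hk Hs H Hm).
Qed.

Lemma moves_fun k x y y' : is_natural mem k -> moves x k y -> moves x k y' -> y = y'.
Proof. intros Hk; exact (iter_unique Ho (@move_fun) Hk). Qed.

(** Instead of truncating the given computation, one up to [k] is prolonged by a move and compared
    with it by uniqueness. *)
Lemma moves_succ k s x z : is_natural mem k -> is_succ mem s k -> mem x A ->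
  moves x s z -> exists y, moves x k y /\ move k y z.
Proof.
intros Hk Hs Hx Hz; destruct (moves_total Hk Hx) as (y & Hy & H).
destruct (move_total k Hy) as (z' & Hz' & Hm); exists y; split; trivial.
rewrite (moves_fun (nat_succ Hk Hs) Hz (iter_succ Hk Hs H Hm)); exact Hm.
Qed.

Lemma moves_zero x y : moves x o y -> y = x.
Proof. intros H; exact (moves_fun (nat_empty Ho) H (iter_zero _ _ Ho)). Qed.

Lemma moves_inj k x x' y : is_natural mem k -> mem x A -> mem x' A ->
  moves x k y -> moves x' k y -> x = x'.
Proof.
intros Hk Hx Hx'; revert y; revert k Hk.
apply (@nat_induction (fun M mem e => forall y,
    iter mem (Submission.move mem (e 2) (e 1) (e 3)) (e 2) (e 4) (e 0) y ->
    iter mem (Submission.move mem (e 2) (e 1) (e 3)) (e 2) (e 5) (e 0) y ->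
    e 4 = e 5) ltac:(def) (A .: o .: f .: x .: x' .: fun _ => o)); simpl.
  intros o' Ho'; rewrite (empty_unique Ho' Ho); intros y H H'.
  rewrite <- (moves_zero H); exact (moves_zero H').
intros k s Hk Hs IH z H H'.
destruct (moves_succ Hk Hs Hx H) as (y & Hy & Hm).
destruct (moves_succ Hk Hs Hx' H') as (y' & Hy' & Hm').
rewrite (move_inj Hm Hm') in Hy; exact (IH y' Hy Hy').
Qed.

(** Move [j] sends every runaway of column [j] away by [column_hop], and no hop ever ends at a
    runaway. Hence the first [k] moves clear all columns below [k]. *)
Lemma moves_column k x y j : is_natural mem k -> mem x A ->
  moves x k y -> column y j -> ~ mem j k.
Proof.
intros Hk Hx; revert y j; revert k Hk.
apply (@nat_induction (fun M mem e => forall y j,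
    iter mem (Submission.move mem (e 2) (e 1) (e 3)) (e 2) (e 4) (e 0) y ->
    Submission.column mem (e 2) (e 1) (e 3) y j -> ~ mem j (e 0)) ltac:(def)
    (A .: o .: f .: x .: fun _ => o)); simpl.
  intros o' Ho' y j _ _; exact (Ho' j).
intros k s Hk Hs IH z j H C Hj.
destruct (moves_succ Hk Hs Hx H) as (y & Hy & [Hm | [N ->]]).
  exact (proj2 (hop_target Hm) (proj1 C)).
apply Hs in Hj; destruct Hj as [Hj | ->]; [exact (IH y j Hy C Hj) |].
destruct (column_hop C) as [z Hz]; exact (N z Hz).
Qed.

(** * The quotient map from ranks to players *)

Lemma quotient_total a : mem a A -> exists b, quotient mem o n A f a b.
Proof.
intros Ha; destruct (moves_total Hn Ha) as (y & Hy & H).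
destruct (classic (runaway y)) as [Hr | Hr].
  (* A remaining runaway would have its column below n, but all of those are cleared after n
     moves. *)
  destruct (runaway_column Hr) as (j & Hj & C); case (moves_column Hn Ha H C Hj).
apply NNPP; intros N; apply Hr; split; trivial.
intros b Hb; apply N; exists b, y; auto.
Qed.

Lemma quotient_fun a b b' :
  quotient mem o n A f a b -> quotient mem o n A f a b' -> b = b'.
Proof.
intros (y & H & Hb) (y' & H' & Hb'); rewrite (moves_fun Hn H H') in Hb.
exact (settled_fun Hb Hb').
Qed.

Lemma quotient_inj a a' b : mem a A -> mem a' A ->
  quotient mem o n A f a b -> quotient mem o n A f a' b -> a = a'.
Proof.
intros Ha Ha' (y & H & Hb) (y' & H' & Hb'); rewrite (settled_inj Hb Hb') in H.
exact (moves_inj Hn Ha Ha' H H').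
Qed.

Lemma quotient_range a b : quotient mem o n A f a b -> mem b B.
Proof. intros (y & _ & H); exact (settled_row H). Qed.

Lemma quotient_injection :
  exists g, is_quotient mem n A B f g /\ is_injection mem g A B.
Proof.
destruct (product_exists A B) as [X HX].
destruct (@separation (fun M mem e => exists a b, mem a (e 1) /\ mem b (e 2) /\
    is_opair mem (e 0) a b /\ Submission.quotient mem (e 3) (e 4) (e 1) (e 5) a b)
    ltac:(def) (A .: B .: o .: n .: f .: fun _ => o) X) as [g Hg]; simpl in Hg.
assert (Hmem : forall z, mem z g <-> exists a b, mem a A /\ mem b B /\
          is_opair mem z a b /\ quotient mem o n A f a b).
  intros z; rewrite Hg; split; [tauto | intros H; split; trivial; apply HX].
  destruct H as (a & b & H); exists a, b; tauto.
assert (Hmaps : forall a b, maps_to mem g a b <-> mem a A /\ quotient mem o n A f a b).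
  intros a b; split.
    intros (z & Hz & Hzp); apply Hmem in Hz; destruct Hz as (a' & b' & Ha & _ & Hz & H).
    destruct (opair_inj Hzp Hz) as [-> ->]; auto.
  intros [Ha H]; destruct (opair_exists a b) as [z Hz]; exists z; split; trivial.
  apply Hmem; exists a, b; repeat split; trivial; exact (quotient_range H).
exists g; split; [exists o; split; trivial | split; [split |]].
- intros z Hz; apply Hmem in Hz; destruct Hz as (a & b & H); exists a, b; tauto.
- intros a Ha; destruct (quotient_total Ha) as [b Hb]; exists b; split.
    apply Hmaps; auto.
  intros b' Hb'; apply Hmaps in Hb'; exact (quotient_fun Hb (proj2 Hb')).
- intros a a' b H H'; apply Hmaps in H, H'; destruct H, H'.
  apply (quotient_inj (b := b)); trivial.
Qed.

End Game.

(** * From a given injection to its quotient *)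

Lemma injection_placement nA nB f : is_product mem nA n A -> is_product mem nB n B ->
  is_injection mem f nA nB -> placement (places mem f).
Proof.
intros HnA HnB [[Hrange Htotal] Hinj]; split.
- intros i a j b (c & p & Hc & Hp & z & Hz & Hzp).
  destruct (Hrange z Hz) as (c' & p' & Hc' & Hp' & Hz').
  destruct (opair_inj Hzp Hz') as [<- <-].
  apply HnA in Hc'; destruct Hc' as (i' & a' & Hi & Ha & E).
  apply HnB in Hp'; destruct Hp' as (j' & b' & Hj & Hb & E').
  destruct (opair_inj Hc E) as [<- <-], (opair_inj Hp E') as [<- <-]; auto.
- intros i a Hi Ha; destruct (opair_exists i a) as [c Hc].
  destruct (Htotal c) as (p & H & _); [apply HnA; exists i, a; auto |].
  destruct (H) as (z & Hz & Hzp); destruct (Hrange z Hz) as (c' & p' & _ & Hp & Hz').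
  destruct (opair_inj Hzp Hz') as [<- <-].
  apply HnB in Hp; destruct Hp as (j & b & _ & _ & Hp); exists j, b, c, p; auto.
- intros i a j b j' b' (c & p & Hc & Hp & H) (c' & p' & Hc' & Hp' & H').
  rewrite <- (opair_unique Hc Hc') in H'.
  assert (Hcn : mem c nA).
    destruct H as (z & Hz & Hzp); destruct (Hrange z Hz) as (d & q & Hd & _ & Hz').
    destruct (opair_inj Hzp Hz') as [<- _]; exact Hd.
  destruct (Htotal c Hcn) as (q & _ & Hq).
  rewrite <- (Hq p H), (Hq p' H') in Hp; exact (opair_inj Hp Hp').
- intros i a i' a' j b (c & p & Hc & Hp & H) (c' & p' & Hc' & Hp' & H').
  rewrite <- (opair_unique Hp Hp') in H'; rewrite (Hinj c c' p H H') in Hc.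
  exact (opair_inj Hc Hc').
Qed.

End Division.

(** The empty set is unique, so the two witnesses for [o] coincide; this makes the quotient
    explicitly definable. *)
Lemma is_quotient_unique n A B f g g' :
  is_quotient mem n A B f g -> is_quotient mem n A B f g' -> g = g'.
Proof.
intros (o & Ho & H) (o' & Ho' & H'); rewrite (empty_unique Ho' Ho) in H'.
apply (ax_extensionality ZF); intros z; rewrite (H z), (H' z); tauto.
Qed.

Lemma division n A B nA nB f : is_natural mem n -> ~ is_empty mem n ->
  is_product mem nA n A -> is_product mem nB n B -> is_injection mem f nA nB ->
  exists g, is_quotient mem n A B f g /\ is_injection mem g A B.
Proof.
intros Hn Hne HnA HnB Hf.
(* The empty set is cut out of [n] by a contradictory condition. *)
destruct (@separation (fun M mem e => ~ e 0 = e 0) ltac:(def) (fun _ => n) n) as [o H].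
assert (Ho : is_empty mem o) by (intros z Hz; apply H in Hz; simpl in Hz; tauto).
destruct (empty_mem_nat Ho Hn) as [-> | Hon]; [case (Hne Ho) |].
exact (quotient_injection Hn Ho Hon (injection_placement HnA HnB Hf)).
Qed.

End SetTheory.

Theorem theorem1 :
  (forall (M : Type) (mem : M -> M -> Prop),
     ZF_without_infinity_powerset mem ->
     forall n A B nA nB : M,
       is_natural mem n -> ~ is_empty mem n ->
       is_product mem nA n A -> is_product mem nB n B ->
       preceq mem nA nB -> preceq mem A B)
  /\
  (exists phi : formula,
     forall (M : Type) (mem : M -> M -> Prop),
       ZF_without_infinity_powerset mem ->
       forall n A B nA nB f : M,
         is_natural mem n -> ~ is_empty mem n ->
         is_product mem nA n A -> is_product mem nB n B ->
         is_injection mem f nA nB ->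
         exists g : M,
           is_injection mem g A B /\
           forall (e : nat -> M) (z : M),
             sat mem (z .: n .: A .: B .: f .: e) phi <-> z = g).
Proof.
split.
  intros M mem ZF n A B nA nB Hn Hne HnA HnB [f Hf].
  destruct (division ZF Hn Hne HnA HnB Hf) as (g & _ & Hg); exists g; exact Hg.
(* The numerals are the positions of n, A, B, f and of the defined set [z] in
   [z .: n .: A .: B .: f .: e]. *)
destruct (def_is_quotient 1 2 3 4 0) as [phi Hphi]; exists phi.
intros M mem ZF n A B nA nB f Hn Hne HnA HnB Hf.
destruct (division ZF Hn Hne HnA HnB Hf) as (g & Hq & Hg); exists g; split; trivial.
intros e z; rewrite Hphi; simpl; split; [| intros ->; exact Hq].
intros Hz; exact (is_quotient_unique ZF Hz Hq).
Qed.
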